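(* Let $n$ be an odd positive integer, let $m=(n-1)/2$, let $k$ be an integer with $1\le k\le m$, and put $$r=2n,\qquad s=\sum_{0\le i\le k-1}2\binom{n}{m-i},\qquad N=\sum_{0\le i\le k}2\binom{n}{m-i}.$$ (i) If $n\equiv 1\pmod 4$, then there exists a square identity of size $[r,s,N]$. (ii) If $n\equiv 3\pmod 4$, then there exists a square identity of size $[r+2,s,N]$.
   Context: For positive integers $r,s,N$, a square identity of size $[r,s,N]$ is an identity $$(a_1^2+\cdots+a_r^2)(b_1^2+\cdots+b_s^2)=c_1^2+\cdots+c_N^2,$$ where $a_1,\dots,a_r,b_1,\dots,b_s$ are independent indeterminates and each $c_i$ is a bilinear form in $(a_1,\dots,a_r)$ and $(b_1,\dots,b_s)$ with integer coefficients. *)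

(* Defs.v *)
From mathcomp Require Import all_boot all_order all_algebra.
From mathcomp Require Export mpoly.

Set Implicit Arguments.
Unset Strict Implicit.
Unset Printing Implicit Defensive.

Import GRing.Theory.
Local Open Scope ring_scope.

(* The r + s indeterminates of {mpoly int[r + s]} are split into
   a_0, ..., a_(r-1) followed by b_0, ..., b_(s-1). *)
Definition avar (r s : nat) (i : 'I_r) : {mpoly int[r + s]} := 'X_(lshift s i).

Definition bvar (r s : nat) (j : 'I_s) : {mpoly int[r + s]} := 'X_(rshift r j).

Definition bilinear_form (r s : nat) (c : {mpoly int[r + s]}) : Prop :=
  exists t : 'I_r -> 'I_s -> int,
    c = \sum_(i < r) \sum_(j < s) t i j *: (avar s i * bvar r j).

Definition square_identity (r s N : nat) : Prop :=
  exists c : 'I_N -> {mpoly int[r + s]},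
    (forall l : 'I_N, bilinear_form (c l)) /\
    (\sum_(i < r) avar s i ^+ 2) * (\sum_(j < s) bvar r j ^+ 2)
      = \sum_(l < N) c l ^+ 2.

(* Main.v *)
(* Consider the 2n Clifford generators e_i + iota_i and I(e_i - iota_i) acting
   on the complexified exterior algebra of R^n: they are Hermitian, square to
   1 and anticommute, and they change the exterior degree by one. Hence they
   map the even part of the 2k middle degrees to the odd part of the 2k + 2
   middle degrees, whose real dimensions are s and N; since their matrices in
   the basis e_T, I e_T (T a subset of [n]) are signed partial permutations,
   this is a square identity of size [2n, s, N]. When n = 3 mod 4, the
   antilinear Hodge-type map C : e_T |-> (-1)^(sum of T) e_(~T) and I C
   can be adjoined to the family. *)
Require Import Defs.
From mathcomp Require Import all_boot all_order all_algebra.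
From mathcomp Require Import zify.

Set Implicit Arguments.
Unset Strict Implicit.
Unset Printing Implicit Defensive.

Import GRing.Theory.

(** * Square identities from signed permutations *)

Section SignedPermutations.
Local Open Scope ring_scope.

(** The form [c l] collects [(-1)^eps i j * a_i * b_j] over [phi i j = l]. In the sum of squares,
    exchanging [j] and [j'] pairs the cross terms with [i != i'], and [eps_odd] gives the two
    partners opposite signs. *)
Lemma square_identity_of_signs (r s N : nat) (phi : 'I_r -> 'I_s -> 'I_N)
    (eps : 'I_r -> 'I_s -> bool)
    (phi_injr : forall i, injective (phi i))
    (phi_injl : forall j, injective (phi^~ j))
    (phi_swap : forall i i' j j',
       phi i j = phi i' j' -> phi i j' = phi i' j)
    (eps_odd : forall i i' j j', i != i' -> phi i j = phi i' j' ->
       eps i j (+) eps i' j (+) (eps i j' (+) eps i' j')) :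
  square_identity r s N.
Proof.
pose t l i j : int := if phi i j == l then (-1) ^+ eps i j else 0.
exists (fun l => \sum_(i < r) \sum_(j < s) t l i j *: (avar s i * bvar r j)).
split=> [l|]; first by exists (t l).
(* Contribution of the pair [(i, j)], [(i', j')] to the sum of all [c l ^+ 2]: nonzero only if both
   land in the same form. *)
pose F i i' j j' : {mpoly int[r + s]} :=
  (if phi i j == phi i' j' then (-1) ^+ (eps i j (+) eps i' j') else 0 : int)
    *: (avar s i * bvar r j * (avar s i' * bvar r j')).
have sumF : \sum_(l < N)
      (\sum_(i < r) \sum_(j < s) t l i j *: (avar s i * bvar r j)) ^+ 2
    = \sum_(i < r) \sum_(i' < r) \sum_(j < s) \sum_(j' < s) F i i' j j'.
  under eq_bigr => l _.
    rewrite expr2 big_distrlr /=.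
    under eq_bigr => i _ do under eq_bigr => i' _ do rewrite big_distrlr /=.
    over.
  rewrite exchange_big; apply: eq_bigr => i _.
  rewrite exchange_big; apply: eq_bigr => i' _.
  rewrite exchange_big; apply: eq_bigr => j _.
  rewrite exchange_big; apply: eq_bigr => j' _.
  rewrite (bigD1 (phi i j)) //= big1 => [|l ne_l].
    rewrite addr0 /F /t eqxx [_ == phi i j]eq_sym.
    case: eqP => _; last by rewrite !scale0r mulr0.
    by rewrite -scalerAl -scalerAr scalerA signr_addb.
  by rewrite /t eq_sym (negPf ne_l) scale0r mul0r.
have sumF' : \sum_(i < r) \sum_(i' < r) \sum_(j < s) \sum_(j' < s) F i i' j j'
    = \sum_(i < r) \sum_(i' < r) \sum_(j < s) \sum_(j' < s) F i i' j' j.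
  by apply: eq_bigr => i _; apply: eq_bigr => i' _; rewrite exchange_big.
have FF i i' j j' : F i i' j j' + F i i' j' j =
    if (i == i') && (j == j') then (avar s i ^+ 2 * bvar r j ^+ 2) *+ 2 else 0.
  rewrite /F; case: (eqVneq i i') => [<-|ne_i] /=.
    rewrite !(inj_eq (phi_injr i)) [j' == j]eq_sym.
    case: eqP => [<-|_]; last by rewrite !scale0r addr0.
    by rewrite addbb scale1r -mulr2n -expr2 exprMn.
  have -> : (phi i j' == phi i' j) = (phi i j == phi i' j').
    by apply/eqP/eqP => /phi_swap.
  case: eqP => [E|_]; last by rewrite !scale0r addr0.
  rewrite -[X in _ *: X + _]mulrA.
  have := eps_odd _ _ _ _ ne_i E.
  have -> : avar s i * (bvar r j * (avar s i' * bvar r j'))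
          = avar s i * bvar r j' * (avar s i' * bvar r j).
    rewrite -mulrA; congr (_ * _).
    by rewrite mulrCA [RHS]mulrCA [bvar r j * _]mulrC.
  rewrite -scalerDl.
  case: (eps i j) (eps i j') (eps i' j) (eps i' j') => [] [] [] [] //= _;
    by rewrite ?subrr ?addNr scale0r.
have : (\sum_(l < N)
      (\sum_(i < r) \sum_(j < s) t l i j *: (avar s i * bvar r j)) ^+ 2) *+ 2
    = ((\sum_(i < r) avar s i ^+ 2) * (\sum_(j < s) bvar r j ^+ 2)) *+ 2.
  rewrite sumF mulr2n {2}sumF' -big_split big_distrlr -sumrMnl /=.
  apply: eq_bigr => i _; rewrite -big_split (bigD1 i) //=.
  rewrite [X in _ + X]big1 => [|i' ne_i].
    rewrite addr0 -big_split -sumrMnl; apply: eq_bigr => j _ /=.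
    rewrite -big_split (bigD1 j) //= FF !eqxx big1 ?addr0 // => j' ne_j.
    by rewrite FF eq_sym (negPf ne_j) andbF.
  rewrite -big_split big1 //= => j _; rewrite -big_split big1 //= => j' _.
  by rewrite FF eq_sym (negPf ne_i).
move=> E; apply/mpolyP => mon; move/(congr1 (mcoeff mon)): E.
by rewrite !mcoeffMn => /Num.Theory.pmulrnI ->.
Qed.

End SignedPermutations.

Lemma square_identity_of_sets (I V : finType) (X Y : {set V})
    (phi : I -> V -> V) (eps : I -> V -> bool)
    (phiXY : forall i x, x \in X -> phi i x \in Y)
    (phi_injr : forall i, injective (phi i))
    (phi_injl : forall x, injective (phi^~ x))
    (phi_swap : forall i i' x x',
       phi i x = phi i' x' -> phi i x' = phi i' x)
    (eps_odd : forall i i' x x', i != i' -> phi i x = phi i' x' ->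
       eps i x (+) eps i' x (+) (eps i x' (+) eps i' x')) :
  square_identity #|I| #|X| #|Y|.
Proof.
have phiY (i : 'I_#|I|) (j : 'I_#|X|) : phi (enum_val i) (enum_val j) \in Y.
  exact/phiXY/enum_valP.
pose f i j := enum_rank_in (phiY i j) (phi (enum_val i) (enum_val j)).
have fE i j : enum_val (f i j) = phi (enum_val i) (enum_val j).
  exact: enum_rankK_in.
have eq_f i i' j j' : f i j = f i' j' ->
    phi (enum_val i) (enum_val j) = phi (enum_val i') (enum_val j').
  by rewrite -!fE => ->.
apply: (@square_identity_of_signs _ _ _ f
  (fun i j => eps (enum_val i) (enum_val j))).
- by move=> i j j' /eq_f /phi_injr /enum_val_inj.
- by move=> j i i' /eq_f /phi_injl /enum_val_inj.
- by move=> i i' j j' /eq_f /phi_swap E; apply: enum_val_inj; rewrite !fE.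
- by move=> i i' j j' ne_i /eq_f; apply: eps_odd; rewrite (inj_eq enum_val_inj).
Qed.

(** * Symmetric differences and parities of subsets *)

Section Parity.
Variable T : finType.
Implicit Types (A B : {set T}) (w : pred T).

Definition symdiff A B := [set x | (x \in A) (+) (x \in B)].

Definition parity w A := \big[addb/false]_x ((x \in A) && w x).

Lemma symdiffC : commutative symdiff.
Proof. by move=> A B; apply/setP => x; rewrite !inE addbC. Qed.

Lemma symdiffA : associative symdiff.
Proof. by move=> A B C; apply/setP => x; rewrite !inE addbA. Qed.

Lemma symdiffK B : involutive (symdiff^~ B).
Proof. by move=> A; apply/setP => x; rewrite !inE addbK. Qed.

Lemma symdiffT A : symdiff A setT = ~: A.
Proof. by apply/setP => x; rewrite !inE addbT. Qed.

Lemma parity_symdiff w A B :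
  parity w (symdiff A B) = parity w A (+) parity w B.
Proof.
by rewrite -big_split; apply: eq_bigr => x _; rewrite inE andb_addl.
Qed.

Lemma parity1 w x : parity w [set x] = w x.
Proof.
rewrite /parity (bigD1 x) //= inE eqxx big1 ?addbF // => y ne_y.
by rewrite inE (negPf ne_y).
Qed.

Lemma card_symdiff1 A x :
  #|symdiff A [set x]| = if x \in A then #|A|.-1 else #|A|.+1.
Proof.
case: ifP => Ax.
  rewrite (cardsD1 x A) Ax; congr #|pred_of_set _|; apply/setP => y; rewrite !inE.
  by case: eqVneq => [->|_]; rewrite ?Ax ?addbF.
have -> : symdiff A [set x] = x |: A.
  apply/setP => y; rewrite !inE.
  by case: eqVneq => [->|_]; rewrite ?Ax ?addbF.
by rewrite cardsU1 Ax.
Qed.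

End Parity.

Lemma parity_setT n (w : pred nat) :
  parity (fun t : 'I_n => w t) setT = odd (\sum_(0 <= t < n) w t).
Proof.
rewrite big_mkord (big_morph odd oddD (erefl : odd 0 = false)).
by apply: eq_bigr => t _; rewrite inE oddb.
Qed.

Lemma parity_ltn n (i : 'I_n) : parity (fun t : 'I_n => t < i) setT = odd i.
Proof.
rewrite (parity_setT n (fun t => t < i)).
rewrite -[nat_of_ord i in RHS]subn0 -[(i - 0)%N]muln1 -sum_nat_const_nat.
rewrite (big_nat_widen 0 i n) 1?ltnW // [in RHS]big_mkcond /=.
by congr odd; apply: eq_bigr => t _; case: (t < i).
Qed.

(** For [n = 4q + 3] there are [2q + 1] odd indices below [n]; each further block of four indices
    adds two. *)
Lemma parity_odd_setT n : n = 3 %[mod 4] ->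
  parity (fun t : 'I_n => odd t) setT.
Proof.
move=> n3; have {n3} [q ->] : exists q, n = q * 4 + 3.
  by exists (n %/ 4); lia.
rewrite parity_setT.
elim: q => [|q IHq].
  by rewrite mul0n; do 3 rewrite big_nat_recr //=; rewrite big_geq.
rewrite (_ : q.+1 * 4 + 3 = (q * 4 + 3).+4); last by lia.
do 4 rewrite big_nat_recr //=.
by lia.
Qed.

(** * Clifford generators as signed permutations *)

Section Clifford.
Variable n : nat.
Let index := (option 'I_n * bool)%type.
Let basis := ({set 'I_n} * bool)%type.

(* (T, false) and (T, true) stand for e_T and I e_T. The index (Some i, c)
   stands for e_i + iota_i (c = false) and I (e_i - iota_i) (c = true), and
   (None, c) for C and I C. *)
Definition cliff_support (o : option 'I_n) : {set 'I_n} :=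
  if o is Some i then [set i] else setT.

Definition cliff_perm (g : index) (x : basis) : basis :=
  (symdiff x.1 (cliff_support g.1), x.2 (+) g.2).

(** The parity of the elements below [i] is the usual exterior sign. The terms guarded by [g.2] come
    from [I^2 = -1] and, for [Some i], from the minus sign of the contraction. The bare [x.2] of the
    [None] case is the antilinearity of C. *)
Definition cliff_sign (g : index) (x : basis) : bool :=
  if g.1 is Some i then
    parity (fun t : 'I_n => t < i) x.1 (+) g.2 && (x.2 (+) (i \in x.1))
  else parity (fun t : 'I_n => odd t) x.1 (+) x.2 (+) g.2 && x.2.

Lemma cliff_perm_injr g : injective (cliff_perm g).
Proof.
case: g => o c [A b] [A' b'] [/(can_inj (symdiffK _)) -> /eqP].
by rewrite (inj_eq (@addIb c)) => /eqP ->.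
Qed.

Lemma cliff_perm_injl x : n != 1 -> injective (cliff_perm^~ x).
Proof.
move=> n1; case: x => A b [o c] [o' c'] [eqA /addbI ->].
have {eqA} : cliff_support o = cliff_support o'.
  by apply: (can_inj (symdiffK A)); rewrite symdiffC eqA symdiffC.
case: o o' => [i|] [i'|] //= => [/set1_inj ->//||] /(congr1 (fun B : {set _} => #|B|));
  rewrite cards1 cardsT card_ord => E;
  by rewrite -E eqxx in n1.
Qed.

(** Each [cliff_perm g] is a translation of an elementary abelian 2-group, so a collision determines
    [x'] from [x]. *)
Lemma cliff_perm_eq g g' x x' : cliff_perm g x = cliff_perm g' x' ->
  x' = (symdiff x.1 (symdiff (cliff_support g.1) (cliff_support g'.1)),
        x.2 (+) (g.2 (+) g'.2)).
Proof.
case: g g' x x' => [o c] [o' c'] [A b] [A' b'] [/= eqA eqb].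
by congr pair; rewrite ?symdiffA ?eqA ?symdiffK // addbA eqb addbK.
Qed.

Lemma cliff_perm_swap g g' x x' : cliff_perm g x = cliff_perm g' x' ->
  cliff_perm g x' = cliff_perm g' x.
Proof.
move/cliff_perm_eq->; case: g g' x => [o c] [o' c'] [A b]; congr pair => /=.
  by apply/setP => y; rewrite !inE; do !case: (_ \in _).
by case: b c c' => [] [] [].
Qed.

(** This is anticommutation. For [i != i'], exactly one of the two exterior parities changes, as
    either [i < i'] or [i' < i]; for [i = i'], the change of [x.2] gives the sign. *)
Lemma cliff_sign_odd g g' x x' :
    (isSome g.1 && isSome g'.1) || (n %% 4 == 3) ->
    g != g' -> cliff_perm g x = cliff_perm g' x' ->
  cliff_sign g x (+) cliff_sign g' x (+) (cliff_sign g x' (+) cliff_sign g' x').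
Proof.
move=> n3 ne_g /cliff_perm_eq ->; case: g g' x n3 ne_g => [o c] [o' c'] [A b].
have n3T : n %% 4 == 3 -> parity (fun t : 'I_n => odd t) setT.
  by move/eqP => ?; apply: parity_odd_setT.
rewrite /cliff_sign /= xpair_eqE.
case: o o' => [i|] [i'|] /=.
- move=> _; rewrite !parity_symdiff !parity1 !inE !eqxx [i' == i]eq_sym !ltnn.
  rewrite (inj_eq Some_inj) -val_eqE.
  case: ltngtP => /= [_ _|_ _|/val_inj <-].
  + case: (i \in A) (i' \in A) b c c' => [] [] [] [] [];
      by do 2![case: (parity _ A)].
  + case: (i \in A) (i' \in A) b c c' => [] [] [] [] [];
      by do 2![case: (parity _ A)].
  + by case: (i' \in A) (parity _ A) b c c' => [] [] [] [] [].
(* The [i] elements below [i] and the weight of [i] itself both contribute [odd i] and cancel. What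
   remains is the parity of the number of odd indices. *)
- move/n3T => n3 _; rewrite !parity_symdiff !parity1 n3 parity_ltn !inE eqxx ltnn.
  case: (i \in A) (odd i) b c c' => [] [] [] [] [];
    by do 2![case: (parity _ A)].
- move/n3T => n3 _; rewrite !parity_symdiff !parity1 n3 parity_ltn !inE eqxx ltnn.
  case: (i' \in A) (odd i') b c c' => [] [] [] [] [];
    by do 2![case: (parity _ A)].
- move/n3T => n3; rewrite !parity_symdiff n3.
  by case: (parity _ A) b c c' => [] [] [] [].
Qed.

End Clifford.

(** * Middle degrees of the exterior algebra *)

Section Layers.
Variables n m : nat.
Hypothesis nE : n = m.*2.+1.

Definition layers (p : bool) (k : nat) : {set {set 'I_n}} :=
  [set A : {set 'I_n} | [&& odd #|A| == p, m < #|A| + k & #|A| <= m + k]].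

Lemma card_layers p k : k <= m.+1 ->
  #|layers p k| = \sum_(0 <= i < k) 'C(n, m - i).
Proof.
elim: k => [|k IHk] le_km.
  rewrite big_geq //; apply/eqP; rewrite cards_eq0; apply/eqP/setP => A.
  by rewrite !inE; lia.
rewrite big_nat_recr //= -IHk; last exact: ltnW.
(* The two new degrees [m - k] and [m + k + 1] add up to the odd number [n]: exactly one has parity
   [p], and their binomials agree. *)
pose j := if odd (m - k) == p then m - k else m + k.+1.
have -> : 'C(n, m - k) = #|[set A : {set 'I_n} | #|A| == j]|.
  rewrite card_draws card_ord /j; case: ifP => // _.
  by rewrite -bin_sub; [congr 'C(_, _)|]; lia.
have -> : layers p k.+1 = layers p k :|: [set A : {set 'I_n} | #|A| == j].
  apply/setP => A; rewrite !inE /j; case: ifP => jp; lia.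
rewrite cardsU (_ : _ :&: _ = set0) ?cards0 ?subn0 //.
by apply/setP => A; rewrite !inE /j; case: ifP => jp; lia.
Qed.

(** A generator moves the degree by one, hence the wider target. Complementation reflects the degree
    to [n - d], which preserves the window and flips the parity since [n] is odd. *)
Lemma cliff_perm_layers k g x : x \in setX (layers false k) setT ->
  cliff_perm g x \in setX (layers true k.+1) setT.
Proof.
case: g x => [o c] [A b]; rewrite !inE /= !andbT => Ak.
case: o => [i|] /=; last first.
  rewrite symdiffT; have := cardsC A; rewrite card_ord.
  by move: #|A| #|~: A| Ak => p q; lia.
(* Without this, the predecessor in [card_symdiff1] could be [0.-1 = 0], which keeps the parity. *)
have A_gt0 : i \in A -> 0 < #|A| by move=> Ai; apply/card_gt0P; exists i.
rewrite card_symdiff1; move: #|A| Ak A_gt0 => p Ak.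
by case: ifP => [_ /(_ isT)|_ _]; lia.
Qed.

End Layers.

Local Open Scope nat_scope.

Theorem theorem2 (n m k r s N : nat)
  (n_pos : 0 < n) (n_odd : odd n)
  (mE : m = (n - 1) %/ 2)
  (k_range : 1 <= k <= m)
  (rE : r = 2 * n)
  (sE : s = \sum_(0 <= i < k) 2 * 'C(n, m - i))
  (NE : N = \sum_(0 <= i < k.+1) 2 * 'C(n, m - i)) :
  (n = 1 %[mod 4] -> square_identity r s N) /\
  (n = 3 %[mod 4] -> square_identity (r + 2) s N).
Proof.
have nE : n = m.*2.+1 by lia.
have /andP[_ le_km] := k_range.
have n1 : n != 1 by lia.
(* The factor 2 of each binomial counts the real and imaginary parts. *)
have sX : s = #|setX (layers n m false k) [set: bool]|.
  by rewrite cardsX cardsT card_bool (card_layers nE) 1?ltnW // sE -big_distrr mulnC.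
have NY : N = #|setX (layers n m true k.+1) [set: bool]|.
  by rewrite cardsX cardsT card_bool (card_layers nE) // NE -big_distrr mulnC.
split=> n4.
  have -> : r = #|{: 'I_n * bool}| by rewrite card_prod card_ord card_bool; lia.
  (* Only the [2n] exterior generators are kept here; anticommutation with C would require [n = 3]
     modulo 4. *)
  pose emb (g : 'I_n * bool) := (Some g.1, g.2).
  have emb_inj : injective emb by move=> [i c] [i' c'] [-> ->].
  rewrite sX NY; apply: (@square_identity_of_sets _ _ _ _
    (fun g => cliff_perm (emb g)) (fun g => cliff_sign (emb g))).
  - by move=> g x; apply: cliff_perm_layers.
  - by move=> g; apply: cliff_perm_injr.
  - by move=> x g g' /cliff_perm_injl => /(_ n1) /emb_inj.
  - by move=> g g' x x'; apply: cliff_perm_swap.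
  - by move=> g g' x x' ne_g; apply: cliff_sign_odd; rewrite ?(inj_eq emb_inj).
have -> : r + 2 = #|{: option 'I_n * bool}|.
  by rewrite card_prod card_option card_ord card_bool; lia.
rewrite sX NY; apply: (@square_identity_of_sets _ _ _ _
  (@cliff_perm n) (@cliff_sign n)).
- by move=> g x; apply: cliff_perm_layers.
- exact: cliff_perm_injr.
- by move=> x; apply: cliff_perm_injl.
- exact: cliff_perm_swap.
- by move=> g g' x x'; apply: cliff_sign_odd; rewrite n4 orbT.
Qed.
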